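(* Let $p$ be a prime number and let $F$ be a free nonabelian group (i.e. a free group of rank at least $2$, possibly infinite). Then there exists a finitely generated $p'$-isolated subgroup $H$ of $F$ which is not separable in the class of finite $p$-groups.
   Context: Let $p$ be a prime. A subgroup $H$ of a group $G$ is $p'$-isolated if for every prime $q \neq p$ and every $g \in G$, $g^q \in H$ implies $g \in H$. Let $\mathcal{K}$ be a class of groups. A subgroup $H$ of a group $G$ is separable in the class $\mathcal{K}$ if for every element $g \in G \setminus H$ there is a homomorphism $\varphi$ of $G$ to some group in $\mathcal{K}$ such that $\varphi(g) \notin \varphi(H)$. *)

(* Defs.v *)
From HB Require Import structures.
From mathcomp Require Import all_boot all_fingroup pgroup.
From mathcomp Require Import boolp classical_sets.

Set Implicit Arguments.
Unset Strict Implicit.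
Unset Printing Implicit Defensive.

Local Open Scope classical_set_scope.
Local Open Scope group_scope.

(* Groups are [groupType]s, possibly infinite; their subgroups are Prop-valued
   [set]s, since membership need not be decidable. *)
Definition is_subgroup (G : groupType) (H : set G) : Prop :=
  [/\ H 1, (forall x y, H x -> H y -> H (x * y))
         & (forall x, H x -> H x^-1)].

Definition finitely_generated (G : groupType) (H : set G) : Prop :=
  exists s : seq G, H = smallest (@is_subgroup G) [set x | x \in s].

(* Universal property. The map to extend is given on all of [F], but only its
   values on [X] matter. *)
Definition free_basis (F : groupType) (X : set F) : Prop :=
  forall (G : groupType) (f : F -> G),
    (exists phi : {multiplicative F -> G}, forall x, X x -> phi x = f x) /\
    (forall phi psi : {multiplicative F -> G},
        (forall x, X x -> phi x = f x) -> (forall x, X x -> psi x = f x) ->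
        phi =1 psi).

Definition free_nonabelian (F : groupType) : Prop :=
  exists X : set F, free_basis X /\ exists x y, [/\ X x, X y & x <> y].

Definition prime'_isolated (p : nat) (G : groupType) (H : set G) : Prop :=
  forall q : nat, prime q -> q != p -> forall g : G, H (g ^+ q) -> H g.

Definition separable_in (K : groupType -> Prop) (G : groupType) (H : set G) :
    Prop :=
  forall g : G, ~ H g ->
    exists (Q : groupType) (phi : {multiplicative G -> Q}),
      K Q /\ ~ (phi @` H) (phi g).

(* [G] is isomorphic to a finite group of [p]-power order; [setTfor] is the
   full finite set of elements, [p.-group] being stated for finite sets. *)
Definition finite_p_group (p : nat) (G : groupType) : Prop :=
  exists (P : finGroupType) (f : {multiplicative P -> G}),
    bijective f /\ p.-group (setTfor P).

(* Main.v *)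
Require Import Defs.
From HB Require Import structures.
From mathcomp Require Import all_boot all_fingroup pgroup.
From mathcomp Require Import gseries maximal.
From mathcomp Require Import boolp classical_sets.

(** Let x, y be two elements of a basis of F and H = <x, (yx)y(yx)^-1>.

    In a finite p-group, the image of H contains the image of x and a conjugate, by
    an element of the image of <x, y>, of the image of y.  Maximal subgroups of
    p-groups being normal, the images of H and <x, y> coincide, so y cannot be
    separated from H.

    H is the stabilizer of a point in an action of F: the Stallings graph of H, with
    trees attached to make all letters act everywhere.  On the three vertices of
    this graph x and y act as increasing partial injections, so that no word acts
    on them with a nontrivial cycle; a closed walk along the powers of a cyclically
    reduced word cannot visit the trees.  Hence H contains every g such that
    g^n lies in H for some n > 0. *)

Set Implicit Arguments.
Unset Strict Implicit.
Unset Printing Implicit Defensive.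

Local Open Scope classical_set_scope.
Local Open Scope group_scope.

(** * The group of bijections of a type *)

Record bijection (T : Type) := Bijection {
  bij_fun : T -> T;
  bij_inv : T -> T;
  bij_funK : cancel bij_fun bij_inv;
  bij_invK : cancel bij_inv bij_fun }.

Lemma bijection_ext (T : Type) (f g : bijection T) :
  bij_fun f =1 bij_fun g -> f = g.
Proof.
case: f g => [f f' fK f'K] [g g' gK g'K] /= /funext fg; subst g.
have fg' : f' = g' by apply/funext => t; rewrite -{1}(g'K t) fK.
by subst g'; congr Bijection; exact: Prop_irrelevance.
Qed.

HB.instance Definition _ (T : Type) := gen_eqMixin (bijection T).
HB.instance Definition _ (T : Type) := gen_choiceMixin (bijection T).

Section BijectionGroup.
Variable T : Type.
Implicit Types f g : bijection T.

Definition bij_one : bijection T :=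
  @Bijection T id id (fun=> erefl) (fun=> erefl).

Definition bij_opp f := Bijection (@bij_invK T f) (@bij_funK T f).

(* Diagrammatic order: a homomorphism into [bijection T] is a right action. *)
Definition bij_mul f g : bijection T :=
  Bijection (can_comp (@bij_funK T g) (@bij_funK T f))
            (can_comp (@bij_invK T f) (@bij_invK T g)).

Lemma bij_mulA : associative bij_mul.
Proof. by move=> f g h; apply: bijection_ext. Qed.

Lemma bij_mul1 : left_id bij_one bij_mul.
Proof. by move=> f; apply: bijection_ext. Qed.

Lemma bij_1mul : right_id bij_one bij_mul.
Proof. by move=> f; apply: bijection_ext. Qed.

Lemma bij_mulV : left_inverse bij_one bij_opp bij_mul.
Proof. by move=> f; apply: bijection_ext => t /=; rewrite bij_invK. Qed.

Lemma bij_Vmul : right_inverse bij_one bij_opp bij_mul.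
Proof. by move=> f; apply: bijection_ext => t /=; rewrite bij_funK. Qed.

HB.instance Definition _ := isGroup.Build (bijection T)
  bij_mulA bij_mul1 bij_1mul bij_mulV bij_Vmul.

Lemma bij_funM f g t : bij_fun (f * g) t = bij_fun g (bij_fun f t).
Proof. by []. Qed.

End BijectionGroup.

(** * Homomorphisms, subgroups and stabilizers *)

Section MultiplicativeGroup.
Variables (G K : groupType) (phi : {multiplicative G -> K}).

Lemma multiplicative1 : phi 1 = 1.
Proof. by apply: (mulgI (phi 1)); rewrite -gmulfM !mulg1. Qed.

Lemma multiplicativeV g : phi g^-1 = (phi g)^-1.
Proof.
by apply: (mulgI (phi g)); rewrite -gmulfM !mulgV multiplicative1.
Qed.

Lemma multiplicativeX g n : phi (g ^+ n) = phi g ^+ n.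
Proof.
by elim: n => [|n IHn]; rewrite ?multiplicative1 // !expgS gmulfM IHn.
Qed.

End MultiplicativeGroup.

Section Subgroup.
Variables (G : groupType) (K : set G) (K_subgroup : is_subgroup K).

Definition subgroup_type of is_subgroup K := {g : G | `[< K g >]}.
Local Notation sG := (subgroup_type K_subgroup).

HB.instance Definition _ := SubChoice.on sG.

Lemma subgroup_closed : group_closed (fun g => `[< K g >]).
Proof.
case: K_subgroup => K1 KM KV; split; first exact/asboolP.
by move=> g h /asboolP Kg /asboolP Kh; apply/asboolP/KM => //; apply: KV.
Qed.

HB.instance Definition _ :=
  SubChoice_isSubGroup.Build G (fun g => `[< K g >]) sG subgroup_closed.

(** The inclusion of [X] extends to a homomorphism into [K]; followed by the embedding of [K], it
    agrees with the identity on [X], hence everywhere. *)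
Lemma free_basis_generates (X : set G) :
  free_basis X -> X `<=` K -> forall g, K g.
Proof.
move=> X_basis XK g.
(* The default value [1] is taken only outside [K], hence never on [X]. *)
have [[phi phiX] _] := X_basis sG (fun h => insubd (1 : sG) h).
have [_ uniq] := X_basis G idfun.
suff -> : g = val (phi g) by apply/asboolP/(valP (phi g)).
apply: (uniq idfun (val \o phi)) => // h Xh /=.
by rewrite phiX // val_insubd ifT //; apply/asboolP/XK.
Qed.

End Subgroup.

Lemma stabilizer_subgroup (T : Type) (G : groupType)
    (phi : {multiplicative G -> bijection T}) t :
  is_subgroup [set g | bij_fun (phi g) t = t].
Proof.
split=> [|g h /= gt ht|g /= gt] /=; first by rewrite multiplicative1.
  by rewrite gmulfM bij_funM gt.
by rewrite multiplicativeV -[in LHS]gt /= bij_funK.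
Qed.

Lemma bij_funX (T : Type) (f : bijection T) n t :
  bij_fun (f ^+ n) t = iter n (bij_fun f) t.
Proof. by elim: n => // n IHn; rewrite expgSr bij_funM IHn. Qed.

Local Open Scope nat_scope.

(** * Words acting on a graph with trees attached *)

Section Automaton.
Variable A : eqType.
Local Notation letter := (A * bool)%type.

Definition linv (l : letter) : letter := (l.1, ~~ l.2).

Lemma linvK : involutive linv.
Proof. by case=> a b; rewrite /linv /= negbK. Qed.

Lemma linv_neq l : l != linv l.
Proof. by case: l => a [] /=; rewrite xpair_eqE andbF. Qed.

Definition nocancel : rel letter := fun l m => m != linv l.

Variable delta : letter -> nat -> option nat.
Hypothesis deltaV : forall l u v, delta l u = Some v -> delta (linv l) v = Some u.
Hypothesis delta_mono : forall l u u' v v',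
  delta l u = Some u' -> delta l v = Some v' -> u < v -> u' < v'.

(* A state [(v, r)] is the vertex reached from the vertex [v] of the core along
   the word [rev r], which leaves the core at once. *)
Definition state := (nat * seq letter)%type.

Definition step (s : state) (l : letter) : state :=
  match s.2 with
  | [::] => if delta l s.1 is Some v then (v, [::]) else (s.1, [:: l])
  | m :: r => if l == linv m then (s.1, r) else (s.1, l :: m :: r)
  end.

(** These stacks are the vertices of the trees: the first letter has no edge at [v] in the core, and
    no two successive letters cancel. *)
Fixpoint reduced_stack v (r : seq letter) : bool :=
  if r is l :: r' then reduced_stack v r' && (step (v, r') l == (v, r))
  else true.

Definition valid (s : state) := reduced_stack s.1 s.2.

Lemma step_valid s l : valid s -> valid (step s l).
Proof.
case: s => v [|m r] /=; rewrite /step /valid /=.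
  by case E: (delta l v) => [u|] //=; rewrite /step /= E eqxx.
move=> /andP[vr E]; case: ifPn => [//|lm] /=.
by rewrite vr E /step /= (negPf lm) eqxx.
Qed.

Lemma stepK s l : valid s -> step (step s l) (linv l) = s.
Proof.
case: s => v [|m r]; rewrite /valid /=.
  move=> _; rewrite /step /=; case E: (delta l v) => [u|] /=; last by rewrite eqxx.
  by rewrite (deltaV E).
move=> /andP[_ /eqP E]; rewrite {2}/step /=; case: ifPn => [/eqP->|_].
  by rewrite linvK.
by rewrite /step /= eqxx.
Qed.

Definition act (s : state) (w : seq letter) := foldl step s w.

Lemma act_cat s w1 w2 : act s (w1 ++ w2) = act (act s w1) w2.
Proof. exact: foldl_cat. Qed.

Lemma act_valid s w : valid s -> valid (act s w).
Proof. by elim: w s => //= l w IHw s /(step_valid l)/IHw. Qed.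

Lemma act_push v m r w :
  path nocancel m w -> act (v, m :: r) w = (v, catrev w (m :: r)).
Proof.
elim: w m r => //= l w IHw m r /andP[ml lw].
by rewrite {1}/step /= (negPf ml) IHw.
Qed.

Lemma size_act_push v m r w :
  path nocancel m w -> size (act (v, m :: r) w).2 = size w + (size r).+1.
Proof. by move=> /act_push->; rewrite /= catrevE size_cat size_rev. Qed.

(** Without cancellation, a letter just pushed cannot be popped by the next one. So either every
    letter so far was a pop, or the walk is in the core, or the last letter is on top. *)
Lemma act_top z w s : path nocancel z w ->
  [\/ size (act s w).2 + size w = size s.2, (act s w).2 = [::]
    | ohead (act s w).2 = Some (last z w)].
Proof.
elim/last_ind: w => [_|w l IHw]; first by constructor 1; rewrite addn0.
rewrite rcons_path last_rcons size_rcons /act foldl_rcons -/(act s w).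
case/andP=> /IHw {IHw}; case: (act s w) => v [|m r] H zl; rewrite /step /=.
  by case: (delta l v) => [u|]; [constructor 2 | constructor 3].
case: ifPn => [/eqP lm|_]; last by constructor 3.
case: H => //= [|[mz]]; first by rewrite addSnnS => ->; constructor 1.
by rewrite -mz /nocancel lm eqxx in zl.
Qed.

(* In a closed walk without cyclic cancellation, a walk starting outside the core
   would either move away from the core forever, or come back to its origin
   through the edge by which it left. *)
Lemma closed_core z s w : path nocancel z w -> last z w = z -> w != [::] ->
  act s w = s -> s.2 = [::].
Proof.
case: s => v [//|m r] zw lz w0 E.
case: (act_top (v, m :: r) zw); rewrite E //=.
  by move/eqP; rewrite -[X in _ == X]addn0 eqn_add2l size_eq0 (negPf w0).
case=> mz; rewrite mz lz in E; case: w zw w0 E {lz mz} => // l w /= /andP[zl lw] _.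
rewrite {1}/step /= (negPf zl) => E; have := size_act_push v (z :: r) lw.
by move/eqP; rewrite E /= addnS -addSn -[X in X == _]add0n eqn_add2r.
Qed.

Lemma act_core_mono z w u u' v v' : path nocancel z w ->
  act (u, [::]) w = (u', [::]) -> act (v, [::]) w = (v', [::]) ->
  u < v -> u' < v'.
Proof.
(* A reduced walk that has left the core never returns, so both walks stay in the core and
   [delta_mono] applies at each letter. *)
have away l x y w' : path nocancel l w' -> act (x, [:: l]) w' <> (y, [::]).
  by move=> /size_act_push sz E; have := sz x [::]; rewrite E addn1.
elim: w z u v => [|l w IHw] z u v /=; first by move=> _ [->] [->].
case/andP=> _ lw; rewrite {1 2}/step /=.
case Eu: (delta l u) => [x|]; last by move/(away _ _ _ _ lw).
case Ev: (delta l v) => [y|]; last by move=> _ /(away _ _ _ _ lw).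
by move=> wu wv uv; apply: IHw lw wu wv _; apply: delta_mono Eu Ev uv.
Qed.

Lemma act_flatten n w s :
  act s (flatten (nseq n w)) = iter n (act^~ w) s.
Proof. by elim: n s => //= n IHn s; rewrite act_cat IHn -iterSr. Qed.

Lemma path_flatten z w n : path nocancel z w -> last z w = z ->
  path nocancel z (flatten (nseq n w)) /\ last z (flatten (nseq n w)) = z.
Proof.
move=> zw lz; elim: n => //= n [IHp IHl].
by rewrite cat_path last_cat lz zw.
Qed.

(** Every iterate is fixed by the [n]-th power of [w], hence lies in the core. There [w] acts
    increasingly, so an orbit that is not constant is strictly monotone and cannot close up. *)
Lemma periodic_reduced z w n s : path nocancel z w -> last z w = z ->
  0 < n -> iter n (act^~ w) s = s -> act s w = s.
Proof.
case: w => // l w; set w' := l :: w => zw lz n0 sn.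
have core k : (iter k (act^~ w') s).2 = [::].
  have [] := path_flatten n zw lz => zwn lzn.
  apply: (closed_core zwn lzn); first by case: n n0 {sn zwn lzn}.
  by rewrite act_flatten -iterD addnC iterD sn.
pose h k := (iter k (act^~ w') s).1.
have hE k : iter k (act^~ w') s = (h k, [::]).
  by rewrite /h -(core k); case: (iter _ _ _).
have hS k : act (h k, [::]) w' = (h k.+1, [::])
  by exact: etrans (congr1 (act^~ w') (esym (hE k))) (hE k.+1).
have hn : h n = h 0 by rewrite /h sn.
have [lt01|lt10|eq01] := ltngtP (h 0) (h 1).
- have hlt k : h k < h k.+1.
    by elim: k => // k; apply: act_core_mono zw (hS _) (hS _).
  by have := homo_ltn ltn_trans hlt n0; rewrite hn ltnn.
- have hlt k : h k > h k.+1.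
    by elim: k => // k; apply: act_core_mono zw (hS _) (hS _).
  have gtn_trans : transitive (fun i j => j < i).
    by move=> i j k ji ik; apply: ltn_trans ik ji.
  by have := homo_ltn gtn_trans hlt n0; rewrite hn ltnn.
- by rewrite -[LHS]/(iter 1 (act^~ w') s) hE -eq01 -hE.
Qed.

Lemma cancellation l w : ~~ path nocancel l w ->
  exists w1 m w2, l :: w = w1 ++ m :: linv m :: w2.
Proof.
elim: w l => //= m w IHw l; case: (eqVneq m (linv l)) => [-> _|ml].
  by exists [::], l, w.
rewrite [X in X && _]ml => /IHw[w1 [m' [w2 E]]].
by exists (l :: w1), m', w2; rewrite E.
Qed.

(** Induction on length reduces to cyclically reduced words: an inner cancelling pair is deleted,
    and outer inverse letters are removed by conjugation. *)
Theorem periodic_fixed w n s : valid s ->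
  0 < n -> iter n (act^~ w) s = s -> act s w = s.
Proof.
move=> + n0; have [k] := ubnP (size w).
elim: k => // k IHk in w s *; rewrite ltnS => wk s_ok.
case: w wk => // l w wk; have [lw|/cancellation] := boolP (path nocancel l w).
  have [zl|] := boolP (nocancel (last l w) l).
    by apply: (@periodic_reduced (last l w)) => //=; rewrite zl.
  rewrite negbK => /eqP; case/lastP: w wk {lw} => [|w z] wk /=.
    by move/eqP; rewrite (negPf (linv_neq l)).
  rewrite last_rcons => E.
  (* The word is a conjugate by [l], so the shorter inner word is periodic at [t]. *)
  pose t := step s l.
  have tE x : valid x -> act x (l :: rcons w z) = step (act (step x l) w) z.
    by rewrite /= /act foldl_rcons.
  have {}tE x : valid x ->
      step (act x (l :: rcons w z)) l = act (step x l) w.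
    move=> x_ok; rewrite tE // E stepK //; exact/act_valid/step_valid.
  have iter_valid i x : valid x -> valid (iter i (act^~ (l :: rcons w z)) x).
    by move=> x_ok; elim: i => //= i; apply: (@act_valid _ (l :: _)).
  have iterE i : step (iter i (act^~ (l :: rcons w z)) s) l = iter i (act^~ w) t.
    by elim: i => // i IHi; rewrite !iterS tE ?IHi //; apply: iter_valid.
  move=> sn; have t_ok : valid t by apply: step_valid.
  have tw : act t w = t.
    apply: IHk => //; first by move: wk; rewrite /= size_rcons; apply: ltnW.
    by rewrite -iterE sn.
  rewrite -[LHS](@stepK _ l); last exact: act_valid.
  by rewrite tE // -/t tw stepK.
case=> w1 [m [w2 E]]; rewrite {}E in wk *.
have wE x : valid x -> act x (w1 ++ m :: linv m :: w2) = act x (w1 ++ w2).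
  by move=> x_ok; rewrite !act_cat /= stepK //; apply: act_valid.
have iterE i : iter i (act^~ (w1 ++ m :: linv m :: w2)) s
    = iter i (act^~ (w1 ++ w2)) s.
  elim: i => // i IHi; rewrite !iterS IHi wE //.
  by elim: i {IHi} => //= i; apply: act_valid.
rewrite iterE wE // => sn; apply: IHk => //.
by apply: leq_trans wk; rewrite !size_cat /= !addnS ltnS leqnSn.
Qed.

(* Extending by the identity outside the valid states makes [step] a bijection. *)
Definition total_step (l : letter) (s : state) :=
  if valid s then step s l else s.

Lemma total_stepK l : cancel (total_step l) (total_step (linv l)).
Proof.
move=> s; rewrite /total_step; case s_ok: (valid s); last by rewrite s_ok.
by rewrite step_valid // stepK.
Qed.

Lemma total_stepVK l : cancel (total_step (linv l)) (total_step l).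
Proof. by move=> s; rewrite -{1}(linvK l) total_stepK. Qed.

End Automaton.

(** * The Stallings graph of the example *)

Section Core.
Variables (A : eqType) (x y : A).

(* The Stallings graph of <x, (yx)y(yx)^-1>: its vertices are the cosets of 1, y
   and yx, numbered so that both generators act increasingly. *)
Definition core (l : A * bool) (v : nat) : option nat :=
  if l.1 == x then
    match v, l.2 with
    | 0, _ => Some 0 | 1, true => Some 2 | 2, false => Some 1 | _, _ => None
    end
  else if l.1 == y then
    match v, l.2 with
    | 0, true => Some 1 | 1, false => Some 0 | 2, _ => Some 2 | _, _ => None
    end
  else None.

Lemma coreV l u v : core l u = Some v -> core (linv l) v = Some u.
Proof.
case: l => a b; rewrite /core /linv /=; case: eqP => _.
  by case: u b => [|[|[|u]]] [] //= [<-].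
by case: eqP => _ //; case: u b => [|[|[|u]]] [] //= [<-].
Qed.

Lemma core_mono l u u' v v' :
  core l u = Some u' -> core l v = Some v' -> u < v -> u' < v'.
Proof.
case: l => a b; rewrite /core /=; case: eqP => _.
  by case: u v b => [|[|[|u]]] [|[|[|v]]] [] //= [<-] [<-].
by case: eqP => _ //; case: u v b => [|[|[|u]]] [|[|[|v]]] [] //= [<-] [<-].
Qed.

End Core.

Local Open Scope group_scope.

(** * Words over a basis and their values *)

Section Word.
Variable G : groupType.

Definition leval (l : G * bool) : G := if l.2 then l.1 else l.1^-1.

Definition weval (w : seq (G * bool)) : G := \prod_(l <- w) leval l.

Lemma leval_linv l : leval (linv l) = (leval l)^-1.
Proof. by case: l => g []; rewrite /leval //= invgK. Qed.

Lemma weval_cons l w : weval (l :: w) = leval l * weval w.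
Proof. exact: big_cons. Qed.

Lemma free_basis_word (X : set G) g : free_basis X ->
  exists w, (forall l, l \in w -> X l.1) /\ g = weval w.
Proof.
move=> X_basis.
pose K := [set g | exists w, (forall l, l \in w -> X l.1) /\ g = weval w].
have K_subgroup : is_subgroup K.
  split; first by exists [::]; rewrite /weval big_nil.
    move=> _ _ [v [Xv ->]] [w [Xw ->]]; exists (v ++ w).
    split; last by rewrite /weval big_cat.
    by move=> l; rewrite mem_cat => /orP[/Xv|/Xw].
  move=> _ [w [Xw ->]]; exists (rev (map (@linv G) w)); split.
    by move=> l; rewrite mem_rev => /mapP[m /Xw Xm ->].
  elim: w {Xw} => [|l w IHw]; first by rewrite /weval !big_nil invg1.
  rewrite weval_cons invgM IHw /= rev_cons -cats1 /weval big_cat big_seq1.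
  by rewrite leval_linv.
apply: (free_basis_generates K_subgroup X_basis) => h Xh.
exists [:: (h, true)]; split; last by rewrite /weval big_seq1.
by move=> l; rewrite inE => /eqP->.
Qed.

End Word.

(** * The subgroup as a point stabilizer *)

Section StallingsExample.
Variables (F : groupType) (x y : F).
Hypothesis xy : x != y.

Local Notation delta := (core x y).
Local Notation base := (0, [::] : seq (F * bool)).

Definition move (z : F) : bijection (state F) :=
  Bijection (total_stepK (@coreV F x y) (z, true))
            (total_stepVK (@coreV F x y) (z, true)).

Definition conj_gen : F := y * x * y * (y * x)^-1.

Local Notation H := (smallest (@is_subgroup F) [set g | g \in [:: x; conj_gen]]).

Lemma smallest_subgroup : is_subgroup H.
Proof.
split=> [K [[K1 _ _] _] //|g h Hg Hh K KH|g Hg K KH].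
  by have [[_ KM _] _] := KH; apply: KM; [apply: Hg | apply: Hh].
by have [[_ _ KV] _] := KH; apply: KV; apply: Hg.
Qed.

Lemma gen_x : H x.
Proof. by apply: sub_gen_smallest; rewrite /= inE eqxx. Qed.

Lemma gen_conj : H conj_gen.
Proof. by apply: sub_gen_smallest; rewrite /= !inE eqxx orbT. Qed.

(* Schreier transversal: acting by [repr s] sends the base state to [s]. *)
Definition repr (s : state F) : F :=
  foldr (fun l g => g * leval l)
    (match s.1 with 0 => 1 | 1%N => y | _ => y * x end) s.2.

(** These are the Schreier generators: edges of the spanning tree give 1, and the two loops give [x]
    and [conj_gen], up to inversion. *)
Lemma repr_core v u l : delta l v = Some u ->
  H (repr (v, [::]) * leval l * (repr (u, [::]))^-1).
Proof.
have [H1 HM HV] := smallest_subgroup.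
case: l => a b; rewrite /core /=; case: eqP => [->|_].
  case: v b => [|[|[|v]]] [] //= [<-]; rewrite /leval /repr /=.
  - by rewrite mul1g invg1 mulg1; apply: gen_x.
  - by rewrite mul1g invg1 mulg1; exact: HV gen_x.
  - by rewrite mulgV.
  - by rewrite mulgK mulgV.
case: eqP => // ->; case: v b => [|[|[|v]]] [] //= [<-]; rewrite /leval /repr /=.
- by rewrite mul1g mulgV.
- by rewrite mulgV mul1g invg1.
- exact: gen_conj.
- by have := HV _ gen_conj; rewrite /conj_gen !invgM !invgK !mulgA.
Qed.

Lemma repr_step s l : H (repr s * leval l * (repr (step delta s l))^-1).
Proof.
have [H1 _ _] := smallest_subgroup.
case: s => v [|m r]; rewrite /step /=.
  by case E: (delta l v) => [u|]; [apply: repr_core | rewrite mulgV].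
case: ifPn => [/eqP->|_]; last by rewrite mulgV.
by rewrite leval_linv /repr /= mulgK mulgV.
Qed.

Lemma repr_act s w : H (repr s * weval w * (repr (act delta s w))^-1).
Proof.
have [H1 HM _] := smallest_subgroup.
elim: w s => [|l w IHw] s; first by rewrite /weval big_nil mulg1 mulgV.
have := HM _ _ (repr_step s l) (IHw (step delta s l)).
by rewrite weval_cons !mulgA mulgVK.
Qed.

Variables (X : set F) (phi : {multiplicative F -> bijection (state F)}).
Hypotheses (X_basis : free_basis X) (Xx : X x) (Xy : X y).
Hypothesis phiX : forall z, X z -> phi z = move z.

Lemma phi_leval s l : X l.1 -> valid delta s ->
  bij_fun (phi (leval l)) s = step delta s l.
Proof.
case: l => z b /= Xz s_ok; case: b; rewrite /leval /=.
  by rewrite phiX //= /total_step s_ok.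
by rewrite multiplicativeV phiX //= /total_step s_ok.
Qed.

Lemma phi_weval s w : (forall l, l \in w -> X l.1) -> valid delta s ->
  bij_fun (phi (weval w)) s = act delta s w.
Proof.
elim: w s => [|l w IHw] s Xw s_ok; first by rewrite /weval big_nil multiplicative1.
rewrite weval_cons gmulfM bij_funM phi_leval //; last exact/Xw/mem_head.
rewrite IHw //; last exact/step_valid.
by move=> m mw; apply: Xw; rewrite inE mw orbT.
Qed.

(** The base has representative 1, so [repr_act] puts its stabilizer inside [H]; conversely both
    generators label closed walks at the base. *)
Lemma stabilizer_base : [set g | bij_fun (phi g) base = base] = H.
Proof.
apply/seteqP; split=> [g /= gb|].
  have [w [Xw gE]] := free_basis_word g X_basis.
  have := repr_act base w; rewrite -phi_weval // -gE gb.
  by rewrite /repr /= mul1g invg1 mulg1.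
apply: smallest_sub; first exact: stabilizer_subgroup.
move=> g /=; rewrite !inE => /orP[/eqP->|/eqP->].
  by rewrite phiX //= /total_step /step /= /core /= eqxx.
have -> : conj_gen = weval [:: (y, true); (x, true); (y, true); (x, false); (y, false)].
  by rewrite /weval !big_cons big_nil /leval /= /conj_gen mulg1 invgM !mulgA.
rewrite phi_weval //; last first.
  by move=> l; rewrite !inE => /or4P[|||/orP[]] /eqP->.
by do ! (rewrite /= ?eqxx ?[y == x]eq_sym ?(negPf xy) /step /core /=).
Qed.

(** [y] moves the base to vertex 1. *)
Lemma conj_gen_notin : ~ H y.
Proof.
rewrite -stabilizer_base /= phiX //= /total_step /step /= /core /=.
by rewrite eq_sym (negPf xy) eqxx.
Qed.

Lemma conj_gen_root_closed g n : 0 < n -> H (g ^+ n) -> H g.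
Proof.
rewrite -stabilizer_base /= => n0.
have [w [Xw ->]] := free_basis_word g X_basis.
rewrite multiplicativeX bij_funX phi_weval // => wn.
apply: (periodic_fixed (@coreV F x y) (@core_mono F x y) _ n0) => //.
rewrite -[RHS]wn; elim: n {n0 wn} => // n IHn; rewrite !iterS -IHn.
rewrite phi_weval //; elim: n {IHn} => //= n; apply: act_valid.
Qed.

End StallingsExample.

(** * Finite p-quotients and the conclusion *)

(* A proper subgroup containing [a] and a conjugate of [c] would lie in a maximal
   subgroup, which is normal and so contains [c] too. *)
Lemma pgroup_gen_conj (p : nat) (P : finGroupType) (M : {group P}) (a c g : P) :
  p.-group (setTfor P) -> a \in M -> c ^ g \in M -> g \in <<[set a; c]%SET>> ->
  c \in M.
Proof.
move=> pP aM cgM gac; pose G := <<[set a; c]%SET>>%G.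
have aG : a \in G by rewrite mem_gen // !inE eqxx.
have cG : c \in G by rewrite mem_gen // !inE eqxx orbT.
have [E|[N maxN MN]] := @maximal_exists _ (M :&: G)%G G (finset.subsetIr _ _).
  by have := cG; rewrite -E inE => /andP[].
have pG : p.-group G by apply: pgroupS pP; apply: finset.subsetT.
have /andP[_ GN] := p_maximal_normal pG maxN.
have aN : a \in N by apply: (fintype.subsetP MN); rewrite inE aM.
have cN : c \in N.
  rewrite -(memJ_norm _ (fintype.subsetP GN g gac)); apply: (fintype.subsetP MN).
  by rewrite inE cgM groupJ.
case/maxgroupP: maxN => /andP[_ /negP GN'] _; case: GN'.
by rewrite gen_subG; apply/fintype.subsetP => z; rewrite !inE => /orP[] /eqP->.
Qed.

Lemma separable_conj_gen_mem p (F : groupType) (x y : F) (H : set F) :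
  is_subgroup H -> H x -> H (conj_gen x y) ->
  separable_in (finite_p_group p) H -> H y.
Proof.
move=> [H1 HM HV] Hx Hc sepH; apply: contrapT => /sepH.
case=> Q [phi [[P [f [[f' fK f'K] pP]]] []]].
have f'M := can2_gmulfM fK f'K.
(* The quotient is transported to the finite group [P], where the image of [H] becomes [M]. *)
pose psi := f' \o phi.
have psiM : {morph psi : u v / u * v} by move=> u v; rewrite /psi /= gmulfM f'M.
suff: psi y \in [set u | `[< (phi @` H) (f u) >]]%SET.
  by rewrite inE f'K => /asboolP.
set M := [set u | _]%SET.
have inM h : H h -> psi h \in M.
  by move=> Hh; rewrite inE f'K; apply/asboolP; exists h.
have M_group : group_set M.
  apply/group_setP; split.
    by rewrite inE multiplicative1; apply/asboolP; exists 1; rewrite ?multiplicative1.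
  move=> u v; rewrite !inE => -[g Hg gu] [h Hh hv].
  by exists (g * h); [apply: HM | rewrite !gmulfM gu hv].
have psi1 : psi 1 = 1 by apply: (mulgI (psi 1)); rewrite -psiM !mulg1.
have psiV u : psi u^-1 = (psi u)^-1.
  by apply: (mulgI (psi u)); rewrite -psiM !mulgV.
(* Since [c ^ g] is [g^-1 * c * g], the conjugator is the inverse of the image of [y * x]. *)
apply: (@pgroup_gen_conj p P (Group M_group) (psi x) _ (psi (y * x))^-1) => //.
- exact: inM.
- by rewrite conjgE invgK -psiV -!psiM !mulgA; apply: inM.
- by rewrite groupV psiM groupM ?mem_gen // !inE eqxx ?orbT.
Qed.

Theorem mainTheorem2 (p : nat) (p_prime : prime p) (F : groupType)
    (F_free : free_nonabelian F) :
  exists H : set F,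
    [/\ is_subgroup H, finitely_generated H, prime'_isolated p H
      & ~ separable_in (finite_p_group p) H].
Proof.
case: F_free => X [X_basis [x [y [Xx Xy /eqP xy]]]].
(* Basis elements other than [x] and [y] have no edge in the core: from there they lead into the
   trees. *)
have [[phi phiX] _] := X_basis (bijection (state F)) (move x y).
exists (smallest (@is_subgroup F) [set g | g \in [:: x; conj_gen x y]]).
have H_subgroup := smallest_subgroup x y; split=> //.
- by exists [:: x; conj_gen x y].
- move=> q q_prime _ g.
  exact: (conj_gen_root_closed xy X_basis Xx Xy phiX (prime_gt0 q_prime)).
- move/(separable_conj_gen_mem H_subgroup (@gen_x F x y) (@gen_conj F x y)).
  exact: (conj_gen_notin xy X_basis Xx Xy phiX).
Qed.
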